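(* Let $M$ be a martingale with the savings property, and let $g=\mathrm{Fcn}(M)$. Let $z\in[0,1]$ be not a dyadic rational. Then the following are equivalent: (i) $M$ succeeds on the binary expansion of $z$; (ii) $\underline Dg(z)=\infty$; (iii) $D_{\mathbb Q}g(z)=\infty$.
   Context: A martingale is $M\colon\{0,1\}^{<\omega}\to[0,\infty)$ with $M(\sigma0)+M(\sigma1)=2M(\sigma)$ for all strings $\sigma$; it succeeds on an infinite bit sequence $Z$ if $M(Z\upharpoonright n)$ is unbounded. $M$ has the savings property if $M(\rho)\ge M(\sigma)-2$ whenever $\rho$ extends $\sigma$. Such an $M$ determines a Borel measure $\mu_M$ on Cantor space with $\mu_M([\sigma])=2^{-|\sigma|}M(\sigma)$; for $M$ with the savings property this measure is atomless, so via binary expansions it is a Borel measure on $[0,1]$ with $\mu_M([0.\sigma,0.\sigma+2^{-|\sigma|}))=2^{-|\sigma|}M(\sigma)$, where $0.\sigma$ is the dyadic rational with binary digits $\sigma$. $\mathrm{Fcn}(M)$ is its distribution function $x\mapsto\mu_M([0,x))$ on $[0,1]$. The binary expansion of $z$ is the one with infinitely many 0s. $S_g(a,b)=\frac{g(a)-g(b)}{a-b}$; $\underline Dg(z)=\liminf_{h\to0}S_g(z,z+h)$; $D_{\mathbb Q}g(z)=\lim_{h\to0^+}\inf\{S_g(a,b): a,b\in[0,1]\cap\mathbb Q,\ a\le z\le b,\ 0<b-a\le h\}$. *)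

(* Defs.v *)
From HB Require Import structures.
From mathcomp Require Import all_boot all_order all_algebra.
From mathcomp Require Import all_classical all_reals all_analysis.
From mathcomp Require Import lra.

Set Implicit Arguments.
Unset Strict Implicit.
Unset Printing Implicit Defensive.

Import Order.TTheory GRing.Theory Num.Theory.
Import numFieldTopology.Exports numFieldNormedType.Exports.

Local Open Scope classical_set_scope.
Local Open Scope ring_scope.

(* Bit strings are [seq bool] with [true] standing for the digit 1; the
   extensions of s by one bit are [rcons s false] and [rcons s true]. *)

Definition martingale (R : realType) (M : seq bool -> R) : Prop :=
  (forall s, 0 <= M s) /\
  (forall s, M (rcons s false) + M (rcons s true) = 2 * M s).

Definition savings (R : realType) (M : seq bool -> R) : Prop :=
  forall s t : seq bool, prefix s t -> M s - 2 <= M t.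

Definition succeeds (R : realType) (M : seq bool -> R) (Z : nat -> bool) : Prop :=
  forall B : R, exists n : nat, B < M (mkseq Z n).

Definition dyadic (R : realType) (z : R) : Prop :=
  exists (m : int) (n : nat), z = m%:~R / 2 ^+ n.

Definition binary_expansion (R : realType) (Z : nat -> bool) (z : R) : Prop :=
  (series (fun i => (Z i)%:R / 2 ^+ i.+1 : R) @ \oo --> z) /\
  (forall n, exists2 m, (n <= m)%N & Z m = false).

(* The dyadic rational 0.s. *)
Definition bin (R : realType) (s : seq bool) : R :=
  \sum_(i < size s) (nth false s i)%:R / 2 ^+ i.+1.

Definition dyadic_itv (R : realType) (s : seq bool) : set R :=
  `[bin R s, bin R s + 2 ^- size s[.
Arguments dyadic_itv : clear implicits.

(* mu is the measure mu_M on [0,1], seen as a Borel measure on R that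
   vanishes off [0,1]. *)
Definition is_martingale_measure (R : realType) (M : seq bool -> R)
    (mu : {measure set (measurableTypeR R) -> \bar R}) : Prop :=
  [/\ mu (~` `[0, 1]) = 0%E,
      forall x : R, mu [set x] = 0%E &
      forall s, mu (dyadic_itv R s) = (2 ^- size s * M s)%:E].

Section construction.
Variables (R : realType) (M : seq bool -> R).
Hypotheses (hM : martingale M) (hS : savings M).

(* lstep n s x is the mass, relative to the cylinder of s rescaled to [0,1],
   of the subcylinders of relative depth n lying below x. *)
Local Fixpoint lstep (n : nat) (s : seq bool) (x : R) : R :=
  if n is n'.+1 then
    (lstep n' (rcons s false) (2 * x) + lstep n' (rcons s true) (2 * x - 1)) / 2
  else if 1 <= x then M s else 0.

Local Definition lcdf s x : R := sup (range (fun n => lstep n s x)).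

Let M0 s : 0 <= M s. Proof. exact: hM.1. Qed.

Let Mhalf s : M s = (M (rcons s false) + M (rcons s true)) / 2.
Proof. by rewrite hM.2; lra. Qed.

Let Mrcons s b : M (rcons s b) <= M s + 2.
Proof.
have h0 : M s - 2 <= M (rcons s false) by apply: hS; exact: prefix_rcons.
have h1 : M s - 2 <= M (rcons s true) by apply: hS; exact: prefix_rcons.
by have := hM.2 s; case: b; lra.
Qed.

Let lstep_le0 n s x : x <= 0 -> lstep n s x = 0.
Proof.
elim: n s x => [|n IH] s x x0 /=; first by rewrite ifF//; lra.
by rewrite !IH; lra.
Qed.

Let lstep_ge1 n s x : 1 <= x -> lstep n s x = M s.
Proof.
elim: n s x => [|n IH] s x x1 /=; first by rewrite x1.
by rewrite !IH ?[RHS]Mhalf; lra.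
Qed.

Let lstep_ge0 n s x : 0 <= lstep n s x.
Proof.
elim: n s x => [|n IH] s x /=; first by case: ifP.
have := IH (rcons s false) (2 * x).
by have := IH (rcons s true) (2 * x - 1); lra.
Qed.

Let lstep_nd n s x y : x <= y -> lstep n s x <= lstep n s y.
Proof.
elim: n s x y => [|n IH] s x y xy /=.
  by case: ifPn => x1; case: ifPn => y1//; lra.
have := IH (rcons s false) (2 * x) (2 * y).
by have := IH (rcons s true) (2 * x - 1) (2 * y - 1); lra.
Qed.

Let lstep_le n s x : lstep n s x <= M s.
Proof.
have [x1|x1] := lerP 1 x; first by rewrite lstep_ge1.
by rewrite -(@lstep_ge1 n s 1)//; apply: lstep_nd; lra.
Qed.

Let lstepS n s x : lstep n s x <= lstep n.+1 s x.
Proof.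
elim: n s x => [|n IH] s x.
  have [x1|x1] := lerP 1 x; first by rewrite !lstep_ge1.
  by rewrite [lstep 0 _ _]/= ifF; [exact: lstep_ge0|lra].
rewrite [leLHS]/= [leRHS]/=.
have := IH (rcons s false) (2 * x).
by have := IH (rcons s true) (2 * x - 1) => /=; lra.
Qed.

Let lcdf_cvg s x : (fun n => lstep n s x) @ \oo --> lcdf s x.
Proof.
apply: nondecreasing_cvgn; first by apply/nondecreasing_seqP => n; exact: lstepS.
by exists (M s) => _ [n _ <-]; exact: lstep_le.
Qed.

Let lcdfE s x : lcdf s x =
  (lcdf (rcons s false) (2 * x) + lcdf (rcons s true) (2 * x - 1)) / 2.
Proof.
have h : (fun n => lstep n.+1 s x) @ \oo --> lcdf s x.
  by rewrite (cvg_shiftS (fun n => lstep n s x)).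
apply/esym/(@cvg_unique _ (@Rhausdorff R) _ _ _ _ _ h).
by apply: cvgM; [apply: cvgD; exact: lcdf_cvg|exact: cvg_cst].
Qed.

Let lcdf_cst s x c : (forall n, lstep n s x = c) -> lcdf s x = c.
Proof.
move=> h; have := @lcdf_cvg s x.
rewrite (_ : (fun n => _) = cst c); last by apply/funext => n; exact: h.
by move/(cvg_unique (@Rhausdorff R)); apply; exact: cvg_cst.
Qed.

Let lcdf_le0 s x : x <= 0 -> lcdf s x = 0.
Proof. by move=> x0; apply: lcdf_cst => n; exact: lstep_le0. Qed.

Let lcdf_ge1 s x : 1 <= x -> lcdf s x = M s.
Proof. by move=> x0; apply: lcdf_cst => n; exact: lstep_ge1. Qed.

Let lcdf_nd s x y : x <= y -> lcdf s x <= lcdf s y.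
Proof.
move=> xy; apply: (ler_cvg_to (@lcdf_cvg s x) (@lcdf_cvg s y)).
by near=> n; exact: lstep_nd.
Unshelve. all: by end_near. Qed.

Let lcdf_bnd s x : 0 <= lcdf s x <= M s.
Proof.
apply/andP; split.
  have [x1|x1] := lerP 0 x; last by rewrite lcdf_le0//; lra.
  by rewrite -(@lcdf_le0 s 0)//; apply: lcdf_nd.
have [x1|x1] := lerP 1 x; first by rewrite lcdf_ge1.
by rewrite -(@lcdf_ge1 s 1)//; apply: lcdf_nd; lra.
Qed.

Let err (n : nat) s : R := 2 ^- n * (M s + 2 * n%:R).

Let errS n s b : err n (rcons s b) / 2 <= err n.+1 s.
Proof.
rewrite /err exprS invfM mulrC -mulrA mulrA.
rewrite -!mulrA ler_pM2l ?invr_gt0// ler_pM2l ?invr_gt0 ?exprn_gt0//.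
by have := Mrcons s b; rewrite -natr1; lra.
Qed.

Let err_small s (e : R) : 0 < e -> exists n, err n s <= e.
Proof.
move=> e0; pose k := Num.bound ((M s + 4) / e).
exists (k + k)%N; rewrite /err exprD invfM.
have k1 : k.+1%:R <= 2 ^+ k :> R by rewrite -natrX ler_nat ltn_expl.
have kM : M s + 4 <= e * k.+1%:R.
  rewrite mulrC -ler_pdivrMr// (le_trans (ltW (archi_boundP _)))//.
    by rewrite divr_ge0 ?(ltW e0)//; have := M0 s; lra.
  by rewrite ler_nat.
have p0 : 0 < 2 ^+ k :> R by rewrite exprn_gt0.
rewrite -mulrA mulrC ler_pdivrMr// mulrC ler_pdivrMr//.
have k0 : 0 <= k%:R :> R by [].
rewrite -natr1 in k1 kM; rewrite natrD.
have h : M s + 2 * (k%:R + k%:R) <= (M s + 4) * (k%:R + 1).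
  by have := M0 s; nra.
apply: (le_trans h).
apply: (@le_trans _ _ (e * (k%:R + 1) * (k%:R + 1))).
  by rewrite ler_wpM2r//; lra.
have : (k%:R + 1) * (k%:R + 1) <= 2 ^+ k * 2 ^+ k :> R by rewrite ler_pM//; lra.
by move/(ler_wpM2l (ltW e0)); lra.
Qed.

Let lcdf_mod n s x : exists2 e : R, 0 < e &
  lcdf s (x + e) - lcdf s x <= err n s /\ lcdf s x - lcdf s (x - e) <= err n s.
Proof.
elim: n s x => [|n IH] s x.
  exists 1 => //; rewrite /err expr0 invr1 mul1r mulr0 addr0.
  have /andP[? ?] := lcdf_bnd s x; have /andP[? ?] := lcdf_bnd s (x + 1).
  by have /andP[? ?] := lcdf_bnd s (x - 1); lra.
have [e1 e10 [h1 h1']] := IH (rcons s false) (2 * x).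
have [e2 e20 [h2 h2']] := IH (rcons s true) (2 * x - 1).
have := errS n s false; have := errS n s true => E2 E1.
have K e : 0 < e -> e <= e1 / 2 -> e <= e2 / 2 ->
    [/\ lcdf (rcons s false) (2 * (x + e)) <= lcdf (rcons s false) (2 * x + e1),
        lcdf (rcons s true) (2 * (x + e) - 1) <= lcdf (rcons s true) (2 * x - 1 + e2),
        lcdf (rcons s false) (2 * x - e1) <= lcdf (rcons s false) (2 * (x - e)) &
        lcdf (rcons s true) (2 * x - 1 - e2) <= lcdf (rcons s true) (2 * (x - e) - 1)].
  by move=> e0 ee1 ee2; split; apply: lcdf_nd; lra.
have e120 : 0 < Num.min (e1 / 2) (e2 / 2) by rewrite lt_min; apply/andP; split; lra.
have m1 : Num.min (e1 / 2) (e2 / 2) <= e1 / 2 by rewrite ge_min lexx.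
have m2 : Num.min (e1 / 2) (e2 / 2) <= e2 / 2 by rewrite ge_min lexx orbT.
move: (Num.min _ _) e120 m1 m2 => d d0 d1 d2.
have [x1|x1|x1] := ltgtP (2 * x) 1.
- have d'0 : 0 < Num.min d ((1 - 2 * x) / 2) by rewrite lt_min; apply/andP; split; lra.
  have m1 : Num.min d ((1 - 2 * x) / 2) <= d by rewrite ge_min lexx.
  have m2 : Num.min d ((1 - 2 * x) / 2) <= (1 - 2 * x) / 2 by rewrite ge_min lexx orbT.
  move: (Num.min _ _) d'0 m1 m2 => e e0 ed ex; exists e => //.
  rewrite !(lcdfE s).
  rewrite !(@lcdf_le0 (rcons s true)); try lra.
  by have [] := K e e0; lra.
- have d'0 : 0 < Num.min d ((2 * x - 1) / 2) by rewrite lt_min; apply/andP; split; lra.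
  have m1 : Num.min d ((2 * x - 1) / 2) <= d by rewrite ge_min lexx.
  have m2 : Num.min d ((2 * x - 1) / 2) <= (2 * x - 1) / 2 by rewrite ge_min lexx orbT.
  move: (Num.min _ _) d'0 m1 m2 => e e0 ed ex; exists e => //.
  rewrite !(lcdfE s).
  rewrite !(@lcdf_ge1 (rcons s false)); try lra.
  by have [] := K e e0; lra.
- exists d => //; rewrite !(lcdfE s).
  rewrite (@lcdf_ge1 (rcons s false) (2 * x)); try lra.
  rewrite (@lcdf_ge1 (rcons s false) (2 * (x + d))); try lra.
  rewrite (@lcdf_le0 (rcons s true) (2 * x - 1)); try lra.
  rewrite (@lcdf_le0 (rcons s true) (2 * (x - d) - 1)); try lra.
  have [? ? ? ?] := K d d0 d1 d2.
  have ? := lcdf_ge1 (rcons s false) (x := 2 * x).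
  have ? := lcdf_le0 (rcons s true) (x := 2 * x - 1).
  lra.
Qed.

Let lcdf_rc : right_continuous (lcdf [::]).
Proof.
move=> x; apply/cvgrPdist_le => e e0.
have [n hn] := err_small [::] e0.
have [d d0 [hd _]] := lcdf_mod n [::] x.
near=> y.
have xy : x <= y by apply: ltW; near: y; exact: nbhs_right_gt.
have yd : y <= x + d.
  apply: ltW; near: y; apply: nbhs_right_lt; lra.
have := @lcdf_nd [::] _ _ xy; have := @lcdf_nd [::] _ _ yd => h1 h2.
by rewrite distrC ger0_norm; lra.
Unshelve. all: by end_near. Qed.

Let F : cumulative R R := HB.pack (lcdf [::])
  (isCumulative.Build R _ R (lcdf [::]) (@lcdf_nd [::]) lcdf_rc).

Let mu : {measure set (measurableTypeR R) -> \bar R} :=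
  lebesgue_stieltjes_measure F.

Let muoc (a b : R) : a <= b -> mu `]a, b]%classic = (F b - F a)%:E.
Proof.
move=> ab; rewrite -(wlength_itv_bnd F false false ab).
exact: (measurable_mu_extE (wlength F) (is_ocitv a b)).
Qed.

Let mu1 (x : R) : mu [set x] = 0%E.
Proof.
apply/eqP; rewrite eq_le measure_ge0 andbT; apply/lee_addgt0Pr => e e0.
have [n hn] := err_small [::] e0.
have [d d0 [_ hd]] := lcdf_mod n [::] x.
have xd : x - d <= x by lra.
rewrite add0e; apply: (@le_trans _ _ (mu `]x - d, x]%classic)).
  apply: le_measure; rewrite ?inE; [exact: measurable_set1|exact: measurable_itv|].
  by move=> _ ->; rewrite /= in_itv/= lexx andbT; lra.
by rewrite muoc// lee_fin (le_trans hd).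
Qed.

Let muN : mu (~` `[0, 1]) = 0%E.
Proof.
apply: measure_negligible; first by apply: measurableC; exact: measurable_itv.
have sub : ~` `[0%R, 1%R]%classic `<=`
    (\bigcup_k `](- k%:R : R), 0%R]%classic) `|`
    (\bigcup_k `]1%R, (1 + k%:R : R)]%classic).
  move=> x /=; rewrite in_itv/= => /negP; rewrite negb_and -!ltNge => /orP[x0|x1].
    left; exists (Num.bound (- x)) => //=; rewrite in_itv/= (ltW x0) andbT.
    by rewrite ltrNl archi_boundP// oppr_ge0 ltW.
  right; exists (Num.bound x) => //=; rewrite in_itv/= x1/=.
  by have := @archi_boundP _ x; lra.
apply: (@negligibleS _ (measurableTypeR R) _ mu _ _ sub).
apply: (@negligibleU _ (measurableTypeR R) _ mu);
  apply: (@negligible_bigcup _ (measurableTypeR R) _ mu) => k.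
  exists `](- k%:R), 0%R]%classic; split => //.
  by rewrite muoc /= ?oppr_le0// !lcdf_le0 ?oppr_le0// subrr.
exists `]1%R, 1 + k%:R]%classic; split => //.
by rewrite muoc /= ?lerDl// !lcdf_ge1 ?lerDl// subrr.
Qed.

Let muco (a b : R) : a < b -> mu `[a, b[%classic = (F b - F a)%:E.
Proof.
move=> ab; rewrite -(muoc (ltW ab)).
have h1 : mu `[a, b]%classic = mu `]a, b]%classic.
  rewrite -(@setU1itv _ _ _ _ false); last by rewrite bnd_simp ltW.
  rewrite measureU//; first by rewrite [X in (X + _)%E](mu1 a) add0e.
  by apply/seteqP; split => // x [/= ->]; rewrite in_itv/= ltxx.
rewrite -h1 -(@setUitv1 _ _ _ _ true); last by rewrite bnd_simp ltW.
rewrite measureU//; first by rewrite [X in (_ + X)%E](mu1 b) adde0.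
by apply/seteqP; split => // x [/= + xb]; rewrite xb in_itv/= ltxx andbF.
Qed.

Let bin_cons b t : bin R (b :: t) = (b%:R + bin R t) / 2.
Proof.
rewrite /bin/= big_ord_recl/= expr1 mulrDl; congr (_ + _).
by rewrite mulr_suml; apply: eq_bigr => i _; rewrite /= exprS invfM mulrA mulrAC.
Qed.

Let bin_bnd t : 0 <= bin R t /\ bin R t + 2 ^- size t <= 1.
Proof.
elim: t => [|b t IH]; first by rewrite /bin big_ord0/= expr0 invr1; lra.
by case: IH => ? ?; rewrite bin_cons/= exprS invfM; case: b => /=; lra.
Qed.

Let lcdf_bin t s :
  lcdf s (bin R t + 2 ^- size t) - lcdf s (bin R t) = 2 ^- size t * M (s ++ t).
Proof.
elim: t s => [|b t IH] s.
  rewrite /bin big_ord0/= expr0 invr1 add0r lcdf_ge1// lcdf_le0// cats0; lra.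
have [b0 b1] := bin_bnd t; have p0 : 0 < 2 ^- size t :> R by rewrite invr_gt0 exprn_gt0.
rewrite !(lcdfE s) bin_cons/= exprS invfM -cat_rcons.
have -> : 2 * ((b%:R + bin R t) / 2 + 2^-1 * 2 ^- size t) =
  b%:R + (bin R t + 2 ^- size t) by lra.
have -> : 2 * ((b%:R + bin R t) / 2) = b%:R + bin R t by lra.
rewrite -[in RHS]mulrA -IH; case: b => /=.
  rewrite 2?(@lcdf_ge1 (rcons s false)); try lra.
  rewrite (_ : 1 + _ - 1 = bin R t + 2 ^- size t); last by lra.
  by rewrite (_ : 1 + bin R t - 1 = bin R t); lra.
rewrite !(@lcdf_le0 (rcons s true)); try lra.
by rewrite !add0r; lra.
Qed.

Lemma martingale_measure_exists :
  exists nu : {measure set (measurableTypeR R) -> \bar R},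
    is_martingale_measure M nu.
Proof.
exists mu; split => // s; rewrite muco ?lcdf_bin//.
by rewrite ltrDl invr_gt0 exprn_gt0.
Qed.

Let bin_rcons t b : bin R (rcons t b) = bin R t + b%:R * 2 ^- (size t).+1.
Proof.
elim: t => [|c t IH]; first by rewrite /= bin_cons /bin !big_ord0 expr1; lra.
by rewrite rcons_cons !bin_cons IH/= !(exprS 2 (size t).+1) invfM; lra.
Qed.

Let M_err t : 2 ^- size t * M t <= err (size t) [::].
Proof.
rewrite /err ler_pM2l ?invr_gt0 ?exprn_gt0//.
elim/last_ind: t => [|t b IH]; first by rewrite mulr0 addr0.
by have := Mrcons t b; rewrite size_rcons -natr1; lra.
Qed.

Let in_dyadic_itv n (x : R) : 0 <= x < 1 ->
  exists2 t, size t = n & bin R t <= x < bin R t + 2 ^- n.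
Proof.
move=> x01; elim: n => [|n [t tn /andP[h1 h2]]].
  by exists [::] => //; rewrite /bin big_ord0 expr0 invr1 add0r.
have e : 2 ^- n = 2 ^- n.+1 + 2 ^- n.+1 :> R by rewrite exprS invfM; lra.
have [xm|xm] := ltrP x (bin R t + 2 ^- n.+1).
  exists (rcons t false); first by rewrite size_rcons tn.
  by rewrite bin_rcons tn /=; apply/andP; split; lra.
exists (rcons t true); first by rewrite size_rcons tn.
by rewrite bin_rcons tn /=; apply/andP; split; lra.
Qed.

Section uniqueness.
Variable nu : {measure set (measurableTypeR R) -> \bar R}.
Hypothesis hnu : is_martingale_measure M nu.

Let nu_le (A B : set (measurableTypeR R)) : measurable A -> measurable B -> A `<=` B ->
  (nu A <= nu B)%E.
Proof. by move=> mA mB; apply: (le_measure nu); rewrite inE. Qed.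

Let nuNy (t : seq bool) : nu `]-oo, bin R t[%classic = (lcdf [::] (bin R t))%:E.
Proof.
have [nN n1 nD] := hnu.
elim/last_ind: t => [|t b IH].
  rewrite /bin big_ord0 lcdf_le0//; apply/eqP.
  rewrite eq_le measure_ge0 andbT -[leRHS]nN; apply: nu_le.
  - exact: measurable_itv.
  - by apply: measurableC; exact: measurable_itv.
  by move=> x /=; rewrite !in_itv/=; lra.
rewrite bin_rcons; case: b => /=; last by rewrite mul0r addr0.
have p0 : 0 < 2 ^- (size t).+1 :> R by rewrite invr_gt0 exprn_gt0.
have e0 : bin R (rcons t false) = bin R t by rewrite bin_rcons mul0r addr0.
have := lcdf_bin (rcons t false) [::].
rewrite size_rcons e0 mul1r => e1.
have -> : `]-oo, bin R t + 2 ^- (size t).+1[%classic =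
    `]-oo, bin R t[%classic `|` dyadic_itv R (rcons t false).
  rewrite /dyadic_itv size_rcons e0.
  apply/seteqP; split => x /=; rewrite !in_itv/=.
    by move=> xb; have [h|h] := ltrP x (bin R t); [left|right; rewrite xb].
  by case=> [|/andP[]]; lra.
rewrite measureU; [|exact: measurable_itv|exact: measurable_itv|].
  rewrite [X in (X + _)%E]IH [X in (_ + X)%E]nD size_rcons -EFinD.
  by congr EFin; rewrite -e1/=; lra.
apply/seteqP; split => // x [/=]; rewrite /dyadic_itv/= e0 !in_itv/= => h1.
by move=> /andP[]; lra.
Qed.

Let nuNyS (t : seq bool) : nu `]-oo, bin R t + 2 ^- size t[%classic =
  (lcdf [::] (bin R t + 2 ^- size t))%:E.
Proof.
have [_ _ nD] := hnu.
have p0 : 0 < 2 ^- (size t) :> R by rewrite invr_gt0 exprn_gt0.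
have -> : `]-oo, bin R t + 2 ^- size t[%classic =
    `]-oo, bin R t[%classic `|` dyadic_itv R t.
  apply/seteqP; split => x /=; rewrite /dyadic_itv/= !in_itv/=.
    by move=> xb; have [h|h] := ltrP x (bin R t); [left|right; rewrite xb].
  by case=> [|/andP[]]; lra.
rewrite measureU; [|exact: measurable_itv|exact: measurable_itv|].
  rewrite [X in (X + _)%E]nuNy [X in (_ + X)%E]nD -EFinD.
  by congr EFin; have := lcdf_bin t [::]; rewrite /=; lra.
apply/seteqP; split => // x [/=]; rewrite /dyadic_itv/= !in_itv/= => h1.
by move=> /andP[]; lra.
Qed.

Let nu_cdf (x : R) : nu `]-oo, x]%classic = (lcdf [::] x)%:E.
Proof.
have [nN n1 nD] := hnu.
have mN : measurable (~` `[0, 1]%classic : set R).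
  by apply: measurableC; exact: measurable_itv.
have [x0|x0] := ltrP x 0.
  rewrite lcdf_le0 ?ltW//; apply/eqP; rewrite eq_le measure_ge0 andbT -[leRHS]nN.
  apply: nu_le => //.
  by move=> y /=; rewrite !in_itv/=; lra.
have [x1|x1] := ltrP x 1; last first.
  have b1 : bin R [::] + 2 ^- size (Nil bool) = 1.
    by rewrite /bin big_ord0/= expr0 invr1; lra.
  have h1 := nuNyS [::]; rewrite b1 lcdf_ge1// in h1.
  rewrite lcdf_ge1//; apply/eqP; rewrite eq_le; apply/andP; split.
    rewrite -h1; apply: (@le_trans _ _
        (nu (`]-oo, 1%R[%classic `|` ([set 1] `|` ~` `[0, 1]%classic)))).
      apply: nu_le; first exact: measurable_itv.
        apply: measurableU; first exact: measurable_itv.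
        by apply: measurableU => //; exact: measurable_set1.
      move=> y /= _; have [y1|y1|->] := ltgtP y 1; last by right; left.
        by left; rewrite in_itv.
      by right; right; rewrite in_itv/=; lra.
    apply: (le_trans (measureU2 _ _ _)); [exact: measurable_itv| |].
      by apply: measurableU => //; exact: measurable_set1.
    rewrite -[leRHS]adde0; apply: leeD => //.
    apply: (le_trans (measureU2 _ _ _)) => //.
    by rewrite [X in (X + _)%E]n1 [X in (_ + X)%E]nN adde0.
  rewrite -h1; apply: nu_le; [exact: measurable_itv|exact: measurable_itv|].
  by move=> y /=; rewrite !in_itv/=; lra.
have K n : (nu `]-oo, x]%classic <= (lcdf [::] x + err n [::])%:E)%E /\
    ((lcdf [::] x - err n [::])%:E <= nu `]-oo, x]%classic)%E.
  have [|t tn /andP[h1 h2]] := @in_dyadic_itv n x; first by rewrite x0.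
  have := M_err t; have := lcdf_bin t [::]; rewrite tn /= => E1 E2.
  have := @lcdf_nd [::] _ _ h1; have := @lcdf_nd [::] _ _ (ltW h2) => E3 E4.
  split.
    apply: (@le_trans _ _ (nu `]-oo, bin R t + 2 ^- size t[%classic)).
      apply: nu_le; [exact: measurable_itv|exact: measurable_itv|].
      by move=> y /=; rewrite !in_itv/= tn; lra.
    by rewrite nuNyS lee_fin tn; lra.
  apply: (@le_trans _ _ (nu `]-oo, bin R t[%classic)).
    by rewrite nuNy lee_fin; lra.
  apply: nu_le; [exact: measurable_itv|exact: measurable_itv|].
  by move=> y /=; rewrite !in_itv/=; lra.
apply/eqP; rewrite eq_le; apply/andP; split; apply/lee_addgt0Pr => e e0;
    have [n hn] := err_small [::] e0; have [K1 K2] := K n.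
  by apply: (le_trans K1); rewrite -EFinD lee_fin; lra.
by rewrite -leeBlDr//; apply: le_trans K2; rewrite -EFinB lee_fin; lra.
Qed.

Local Lemma nuE (A : set (measurableTypeR R)) : measurable A -> mu A = nu A.
Proof.
apply: lebesgue_stieltjes_measure_unique => X /ocitvP[->|[[a b]/= ab ->]].
  by rewrite !measure0.
have := nu_cdf b.
have -> : `]-oo, b]%classic = `]-oo, a]%classic `|` `]a, b]%classic.
  apply/seteqP; split => x /=; rewrite !in_itv/=.
    by move=> xb; have [h|h] := lerP x a; [left|right; apply/andP].
  by case=> [|/andP[]]; lra.
rewrite measureU; [|exact: measurable_itv|exact: measurable_itv|]; last first.
  by apply/seteqP; split => // x [/=]; rewrite !in_itv/= => h1 /andP[]; lra.
rewrite [X in (X + _)%E]nu_cdf => h.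
have /= -> := muoc (ltW ab).
by rewrite EFinB -h addeAC subee// add0e.
Qed.

End uniqueness.

Lemma martingale_measure_unique
    (nu1 nu2 : {measure set (measurableTypeR R) -> \bar R}) :
  is_martingale_measure M nu1 -> is_martingale_measure M nu2 ->
  forall A : set R, measurable A -> nu1 A = nu2 A.
Proof. by move=> h1 h2 A mA; rewrite -(nuE h1)// (nuE h2). Qed.

End construction.

Definition martingale_measure (R : realType) (M : seq bool -> R)
    (hM : martingale M) (hS : savings M) :
    {measure set (measurableTypeR R) -> \bar R} :=
  sval (cid (martingale_measure_exists hM hS)).

Lemma martingale_measureP (R : realType) (M : seq bool -> R)
    (hM : martingale M) (hS : savings M) :
  is_martingale_measure M (martingale_measure hM hS).
Proof. exact: svalP (cid (martingale_measure_exists hM hS)). Qed.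

Definition Fcn (R : realType) (M : seq bool -> R)
    (hM : martingale M) (hS : savings M) (x : R) : R :=
  fine (martingale_measure hM hS `[0, x[%classic).

Definition slope (R : realType) (g : R -> R) (a b : R) : R :=
  (g a - g b) / (a - b).

(* In the next two definitions g is a function on [0,1]: its values outside
   [0,1] are never used. *)

Definition lower_derivative (R : realType) (g : R -> R) (z : R) : \bar R :=
  limf_einf (fun h : R => (slope g z (z + h))%:E)
    (within [set h : R | 0 <= z + h <= 1] 0^').

Definition rational_slopes (R : realType) (g : R -> R) (z h : R) : set \bar R :=
  [set y | exists p q : rat, let a : R := ratr p in let b : R := ratr q in
    [/\ 0 <= a <= 1, 0 <= b <= 1, a <= z <= b, 0 < b - a <= h &
        y = (slope g a b)%:E]].

(* The infimum is monotone in h, so the limit always exists in \bar R. *)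
Definition rational_derivative (R : realType) (g : R -> R) (z : R) : \bar R :=
  lim (ereal_inf (rational_slopes g z h) @[h --> 0^'+]).

(* Main.v *)
(** M (t) is the slope of g over the dyadic interval of t. If M exceeds c + 2 at
    a prefix s of Z, the savings property keeps M, hence all dyadic slopes, above
    c inside the interval of s; by bisection and monotonicity all slopes there
    are at least c, and z is interior because it is not dyadic. Conversely a
    slope across z averages two slopes at z, and the dyadic intervals around z
    have rational endpoints, so an infinite rational derivative forces M to be
    unbounded along Z. *)

Require Import Defs.
From HB Require Import structures.
From mathcomp Require Import all_boot all_order all_algebra.
From mathcomp Require Import all_classical all_reals all_analysis.
From mathcomp Require Import lra.
Import Order.TTheory GRing.Theory Num.Theory.
Import numFieldTopology.Exports numFieldNormedType.Exports.
Local Open Scope classical_set_scope.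
Local Open Scope ring_scope.

(** * Dyadic intervals and prefixes of a binary expansion *)

Section dyadic_intervals.
Context {R : realType}.
Implicit Types (s t : seq bool) (x : R).

Definition top s : R := bin R s + 2 ^- size s.

Lemma exp2V_gt0 n : 0 < 2 ^- n :> R.
Proof. by rewrite invr_gt0 exprn_gt0. Qed.

Lemma exp2VS n : 2 ^- n = 2 ^- n.+1 + 2 ^- n.+1 :> R.
Proof. by rewrite exprS invfM; lra. Qed.

Lemma exp2V_le1 n : 2 ^- n <= 1 :> R.
Proof.
elim: n => [|n]; first by rewrite expr0 invr1.
by rewrite (exp2VS n); have := exp2V_gt0 n.+1; lra.
Qed.

Lemma exp2V_lt_gt0 (e : R) : 0 < e -> exists n, 2 ^- n < e.
Proof.
move=> e0; exists (Num.bound e^-1).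
have h : e^-1 < 2 ^+ Num.bound e^-1.
  apply: (lt_trans (archi_boundP _)); first by rewrite invr_ge0 ltW.
  by rewrite -natrX ltr_nat ltn_expl.
by rewrite -[ltRHS]invrK ltf_pV2// posrE ?invr_gt0// exprn_gt0.
Qed.

(** The error term tends to 0 as [m] grows. The offset [n] is there because the errors arise from
    [m] halvings of an interval of length [2 ^- n]. *)
Lemma ler_add_exp2V (a b c : R) n :
  (forall m, a <= b + c * 2 ^- (n + m)) -> a <= b.
Proof.
move=> h; rewrite leNgt; apply/negP => ba.
have [c0|c0] := lerP c 0.
  by have := h 0%N; have := exp2V_gt0 (n + 0); nra.
have [m hm] : exists m, 2 ^- m < (a - b) / c.
  by apply: exp2V_lt_gt0; rewrite divr_gt0//; lra.
have := h m; rewrite exprD invfM; move: hm; rewrite ltr_pdivlMr//.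
by have := exp2V_le1 n; have := exp2V_gt0 n; have := exp2V_gt0 m; nra.
Qed.

Lemma bin_rcons t b : bin R (rcons t b) = bin R t + b%:R * 2 ^- (size t).+1.
Proof.
rewrite /bin size_rcons big_ord_recr/= nth_rcons ltnn eqxx; congr (_ + _).
by apply: eq_bigr => i _; rewrite nth_rcons ltn_ord.
Qed.

Lemma bin_rcons0 t : bin R (rcons t false) = bin R t.
Proof. by rewrite bin_rcons mul0r addr0. Qed.

Lemma top_rcons0 t : top (rcons t false) = bin R (rcons t true).
Proof. by rewrite /top bin_rcons0 bin_rcons size_rcons mul1r. Qed.

Lemma top_rcons1 t : top (rcons t true) = top t.
Proof. by rewrite /top bin_rcons size_rcons mul1r (exp2VS (size t)) addrA. Qed.

Lemma bin_lt_top t : bin R t < top t.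
Proof. by rewrite ltrDl exp2V_gt0. Qed.

Lemma bin_rcons_itv t b : bin R t <= bin R (rcons t b) /\ top (rcons t b) <= top t.
Proof.
have h0 := bin_lt_top (rcons t false); have h1 := bin_lt_top (rcons t true).
move: h0 h1; case: b; rewrite ?bin_rcons0 ?top_rcons0 ?top_rcons1 => h0 h1;
  by split=> //; apply: ltW.
Qed.

Lemma bin_itv01 t : 0 <= bin R t /\ top t <= 1.
Proof.
elim/last_ind: t => [|t b [t0 t1]].
  by rewrite /top /bin big_ord0/= expr0 invr1 add0r.
by have [h0 h1] := bin_rcons_itv t b; split; lra.
Qed.

Lemma bin_ratr t : exists p : rat, bin R t = ratr p.
Proof.
exists (\sum_(i < size t) (nth false t i)%:R / 2 ^+ i.+1).
rewrite rmorph_sum; apply: eq_bigr => i _.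
by rewrite fmorph_div rmorphXn !rmorph_nat.
Qed.

Lemma top_ratr t : exists p : rat, top t = ratr p.
Proof.
have [p hp] := bin_ratr t; exists (p + 2 ^- size t).
by rewrite rmorphD /top hp fmorphV rmorphXn rmorph_nat.
Qed.

Lemma dyadic_bin t : dyadic (bin R t).
Proof.
elim/last_ind: t => [|t b [m [n]]].
  by exists 0%:Z, 0%N; rewrite /bin big_ord0 mul0r.
rewrite bin_rcons => ->.
exists (m * 2 ^+ (size t).+1 + b%:Z * 2 ^+ n), (n + (size t).+1)%N.
rewrite rmorphD !rmorphM !rmorphXn/= exprD.
have n0 k : 2 ^+ k != 0 :> R by rewrite expf_neq0.
rewrite mulrDl invfM; congr (_ + _).
  by rewrite mulrACA divff ?mulr1.
by rewrite [_^-1 * _]mulrC mulrACA divff ?mulr1.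
Qed.

Lemma dyadic_top t : dyadic (top t).
Proof.
have [m [n hm]] := dyadic_bin t.
exists (m * 2 ^+ size t + 2 ^+ n), (n + size t)%N.
rewrite /top hm rmorphD !rmorphM !rmorphXn/= exprD.
have n0 k : 2 ^+ k != 0 :> R by rewrite expf_neq0.
by rewrite mulrDl invfM mulrACA divff// mulr1 mulrA divff// mul1r.
Qed.

(** The intervals of the prefixes are nested and their left ends are the partial sums of the series,
    so the bounds pass to the limit. Limits keep only weak inequalities; strict ones will come from
    [x] not being dyadic. *)
Lemma binary_expansion_itv (Z : nat -> bool) x n :
  binary_expansion Z x -> bin R (mkseq Z n) <= x <= top (mkseq Z n).
Proof.
move=> [cZ _].
have sE k : series (fun i => (Z i)%:R / 2 ^+ i.+1 : R) k = bin R (mkseq Z k).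
  rewrite /series/= /bin size_mkseq big_mkord.
  by apply: eq_bigr => i _; rewrite nth_mkseq.
have mono k : (n <= k)%N -> bin R (mkseq Z n) <= bin R (mkseq Z k) /\
    top (mkseq Z k) <= top (mkseq Z n).
  move=> /subnKC <-; elim: (k - n)%N => [|j [IH1 IH2]]; first by rewrite addn0.
  rewrite addnS mkseqS.
  by have [h1 h2] := bin_rcons_itv (mkseq Z (n + j)) (Z (n + j)%N); split; lra.
apply/andP; split.
  apply: (cvgr_to_ge cZ); exists n => // k /= /mono[h1 _].
  by rewrite sE.
apply: (cvgr_to_le cZ); exists n => // k /= /mono[_ h2].
by rewrite sE; apply: ltW; apply: lt_le_trans h2; exact: bin_lt_top.
Qed.

End dyadic_intervals.

(** * From lower bounds on dyadic slopes to all slopes *)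

(* g x - c * x can decrease by at most c times the length of a dyadic interval,
   since g is monotone, and does not decrease from end to end of one; so m
   halvings of the interval of t bound its decrease by c * 2 ^- (size t + m). *)
Section dyadic_slopes.
Context {R : realType} (g : R -> R) (c : R) (s : seq bool).
Hypothesis c_ge0 : 0 <= c.
Hypothesis g_nd : forall x y, 0 <= x -> x <= y -> y <= 1 -> g x <= g y.
Hypothesis g_slope : forall t, prefix s t ->
  c * 2 ^- size t <= g (top t) - g (bin R t).

Let prefix_rconsr t b : prefix s t -> prefix s (rcons t b).
Proof. by move=> st; apply: prefix_trans st (prefix_rcons _ _). Qed.

Let G x := g x - c * x.

Let G_child t b : prefix s t -> G (bin R (rcons t b)) <= G (top (rcons t b)).
Proof.
move=> /(prefix_rconsr _ b)/g_slope; rewrite /G /top.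
by move: (g (_ + _)) => ?; lra.
Qed.

Let G_close t x y : bin R t <= x -> x <= y -> y <= top t ->
  G x <= G y + c * 2 ^- size t.
Proof.
move=> tx xy yt; rewrite /G.
have [? ?] := bin_itv01 (R := R) t.
have := g_nd x y; have : c * (y - x) <= c * 2 ^- size t.
  by apply: ler_wpM2l => //; move: yt; rewrite /top; lra.
lra.
Qed.

(** Recursion into the half that contains [x]. The other half is crossed from end to end by
    [G_child] at no cost, so the error is only that of the last interval reached. *)
Let G_ends m t x : prefix s t -> bin R t <= x -> x <= top t ->
  G (bin R t) <= G x + c * 2 ^- (size t + m) /\
  G x <= G (top t) + c * 2 ^- (size t + m).
Proof.
elim: m t x => [|m IH] t x st tx xt.
  by rewrite addn0; split; apply: G_close.
have c0 := G_child t false st; have c1 := G_child t true st.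
rewrite top_rcons0 top_rcons1 bin_rcons0 in c0 c1.
have [xm|xm] := lerP x (top (rcons t false)).
  have [|||] := IH (rcons t false) x; rewrite ?bin_rcons0 ?top_rcons0//.
  - exact: prefix_rconsr.
  - by rewrite -top_rcons0.
  by rewrite size_rcons addSnnS; split; lra.
have [|||] := IH (rcons t true) x; rewrite ?top_rcons1//.
- exact: prefix_rconsr.
- by rewrite -top_rcons0 ltW.
by rewrite size_rcons addSnnS; split; lra.
Qed.

Let G_pair m t x y : prefix s t -> bin R t <= x -> x <= y -> y <= top t ->
  G x <= G y + c * 2 ^- (size t + m).
Proof.
elim: m t x y => [|m IH] t x y st tx xy yt; first by rewrite addn0; exact: G_close.
have s0 := prefix_rconsr t false st; have s1 := prefix_rconsr t true st.
have [ym|ym] := lerP y (top (rcons t false)).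
  by have := IH (rcons t false) x y; rewrite bin_rcons0 size_rcons addSnnS; exact.
have [xm|xm] := lerP x (top (rcons t false)); last first.
  have := IH (rcons t true) x y; rewrite -top_rcons0 top_rcons1 size_rcons addSnnS.
  by apply=> //; exact: ltW.
(* Here the midpoint separates [x] from [y]. Adding two errors would spoil the induction, but each
   comparison with the midpoint is a [G_ends] bound for every depth [k], hence exact in the
   limit. *)
have x_mid : G x <= G (top (rcons t false)).
  apply: (@ler_add_exp2V _ _ _ c (size (rcons t false))) => k.
  by have [|||] := G_ends k (rcons t false) x; rewrite ?bin_rcons0.
have mid_y : G (top (rcons t false)) <= G y.
  apply: (@ler_add_exp2V _ _ _ c (size (rcons t true))) => k.
  rewrite top_rcons0; have [|||//] := G_ends k (rcons t true) y; rewrite ?top_rcons1//.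
  by rewrite -top_rcons0 ltW.
have : 0 <= c * 2 ^- (size t + m.+1) by rewrite mulr_ge0// ltW// exp2V_gt0.
lra.
Qed.

Lemma dyadic_slope_ge x y : bin R s <= x -> x <= y -> y <= top s ->
  c * (y - x) <= g y - g x.
Proof.
move=> sx xy ys.
have : G x <= G y.
  by apply: (@ler_add_exp2V _ _ _ c (size s)) => m; exact: G_pair (prefix_refl s) _ _ _.
by rewrite /G; lra.
Qed.

End dyadic_slopes.

(** * Infinite derivatives expressed by bounds on slopes *)

Section infinite_derivatives.
Context {R : realType}.
Implicit Types (g : R -> R) (z : R).

Lemma ereal_sup_eqyP (S : set \bar R) :
  ereal_sup S = +oo%E <-> forall B : R, exists2 y, S y & (B%:E <= y)%E.
Proof.
split=> [Sy B|h].
  have [|y Sy' By] := @ereal_sup_gt R S B%:E; first by rewrite Sy ltry.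
  by exists y => //; exact: ltW.
apply/eqyP => B _; have [y Sy By] := h B.
by apply: (le_trans By); exact: ereal_sup_ubound.
Qed.

Lemma lower_derivative_eqyP g z :
  lower_derivative g z = +oo%E <->
  forall B : R, exists2 d, 0 < d & forall x, x != z -> `|x - z| < d ->
    0 <= x <= 1 -> B <= slope g z x.
Proof.
rewrite /lower_derivative limf_einfE ereal_sup_eqyP; split => h B.
  have [_ [A Az <-] BA] := h B.
  move: Az => /nbhs_ballP[d /= d0 dA]; exists d => // x xz xd x01.
  rewrite -lee_fin; apply: (le_trans BA); apply: ereal_inf_lbound.
  exists (x - z); last by rewrite addrC subrK.
  apply: dA => //=; rewrite ?subr_eq0//; first by rewrite /ball/= sub0r normrN.
  by rewrite addrC subrK.
have [d d0 hd] := h B.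
(* All the increments that [hd] controls; they form a member of the filter, so the infimum over them
   bounds the limit inferior from below. *)
pose A : set R := [set k | [/\ k != 0, `|k| < d & 0 <= z + k <= 1]].
exists (ereal_inf [set (slope g z (z + k))%:E | k in A]).
  exists A => //; apply/nbhs_ballP; exists d => //= k.
  by rewrite /ball/= sub0r normrN => kd k0 k01; split.
apply: le_ereal_inf_tmp => _ [k [k0 kd k01] <-]; rewrite lee_fin.
have e : z + k - z = k by rewrite addrAC subrr add0r.
by apply: hd; rewrite ?e// -subr_eq0 e.
Qed.

Lemma rational_derivative_eqyP g z :
  rational_derivative g z = +oo%E <->
  forall B : R, exists2 d, 0 < d & forall p q : rat,
    0 <= (ratr p : R) -> ratr p <= z -> z <= ratr q -> (ratr q : R) <= 1 ->
    0 < (ratr q - ratr p : R) <= d -> B <= slope g (ratr p) (ratr q).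
Proof.
(* A larger [h] admits more slopes, so the infimum is nonincreasing in [h] and its limit at 0 from
   the right is a supremum. *)
have -> : rational_derivative g z =
    ereal_sup [set ereal_inf (rational_slopes g z h) | h in `]0, +oo[].
  rewrite /rational_derivative.
  apply: cvg_lim => //; apply: nonincreasing_at_right_cvge => //.
  move=> h k _ _ hk; apply: ereal_inf_le_tmp => _ [p [q [p01 q01 pq /andP[h0 qp] ->]]].
  by exists p, q; split => //; rewrite h0 (le_trans qp).
rewrite ereal_sup_eqyP; split => h B.
  have [_ [d /= + <-] Bd] := h B; rewrite in_itv/= andbT => d0.
  exists d => // p q p0 pz zq q1 pq.
  rewrite -lee_fin; apply: (le_trans Bd); apply: ereal_inf_lbound.
  by exists p, q; split=> //; apply/andP; split=> //; lra.
have [d d0 hd] := h B.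
exists (ereal_inf (rational_slopes g z d)); first by exists d => //=; rewrite in_itv/= d0.
apply: le_ereal_inf_tmp => _ [p [q [/andP[p0 p1] /andP[q0 q1] /andP[pz zq] pq ->]]].
by rewrite lee_fin; apply: hd.
Qed.

(** Without the denominator, bounds over adjacent intervals add up, and the right-hand inequality
    still makes sense on an interval of length 0. *)
Lemma slope_geE g (a b c : R) : a < b ->
  (c <= slope g a b) = (c * (b - a) <= g b - g a).
Proof.
by move=> ab; rewrite /slope -mulrNN -invrN !opprB ler_pdivlMr ?subr_gt0.
Qed.

Lemma slopeC g (a b : R) : slope g a b = slope g b a.
Proof. by rewrite /slope -mulrNN -invrN !opprB. Qed.

Lemma lower_rational_derivative g z :
  lower_derivative g z = +oo%E -> rational_derivative g z = +oo%E.
Proof.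
move=> /lower_derivative_eqyP h; apply/rational_derivative_eqyP => B.
(* The halving turns the weak bound on [b - a] into the strict bound that [hd] asks for. *)
have [d d0 hd] := h B; exists (d / 2); first by rewrite divr_gt0.
move=> p q; move: (ratr p) (ratr q) => a b a0 az zb b1 /andP[ab abd].
rewrite slope_geE; last by rewrite -subr_gt0.
have ga : B * (z - a) <= g z - g a.
  (* A rational [z] may be an endpoint itself; its side then contributes [0 <= 0]. *)
  have [->|naz] := eqVneq a z; first by rewrite !subrr mulr0.
  rewrite -slope_geE ?lt_neqAle ?naz// slopeC; apply: hd => //; last by lra.
  by rewrite distrC ger0_norm; lra.
have gb : B * (b - z) <= g b - g z.
  have [->|nbz] := eqVneq b z; first by rewrite !subrr mulr0.
  rewrite -slope_geE ?lt_neqAle 1?eq_sym ?nbz//; apply: hd => //; last by lra.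
  by rewrite ger0_norm; lra.
lra.
Qed.

End infinite_derivatives.

(** * The distribution function of the martingale measure *)

Section Fcn_theory.
Context {R : realType} {M : seq bool -> R} (hM : martingale M) (hS : savings M).
Let mu := martingale_measure hM hS.
Let g := Fcn hM hS.

(** The interval lies in that of the empty string, whose mass is [M [::]]. Finiteness is what makes
    [fine] additive in [Fcn_sub]. *)
Let mu_fin (a b : R) : 0 <= a -> b <= 1 -> mu `[a, b[%classic \is a fin_num.
Proof.
move=> a0 b1; rewrite ge0_fin_numE//.
have [_ _ /(_ [::]) m1] := martingale_measureP hM hS.
apply: le_lt_trans (ltry (2 ^- size (Nil bool) * M [::])); rewrite -m1.
apply: le_measure; rewrite ?inE; [exact: measurable_itv|exact: measurable_itv|].
have [e0 e1] : bin R [::] = 0 /\ 2 ^- size (Nil bool) = 1 :> R.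
  by rewrite /bin big_ord0 expr0 invr1.
by move=> x; rewrite /Defs.dyadic_itv e0 e1 /= !in_itv/=; lra.
Qed.

Lemma Fcn_sub (a b : R) : 0 <= a -> a <= b -> b <= 1 ->
  g b - g a = fine (mu `[a, b[%classic).
Proof.
move=> a0 ab b1; rewrite /g /Fcn -/mu.
have -> : `[0, b[%classic = `[0, a[%classic `|` `[a, b[%classic :> set R.
  apply/seteqP; split=> x /=; rewrite !in_itv/=; last by case; lra.
  by move=> /andP[x0 xb]; have [xa|xa] := ltrP x a; [left|right]; apply/andP.
rewrite measureU; [|exact: measurable_itv|exact: measurable_itv|].
  by rewrite fineD ?mu_fin//; [rewrite addrAC subrr add0r|lra].
by apply/seteqP; split => // x []/=; rewrite !in_itv/=; lra.
Qed.

Lemma Fcn_nd (x y : R) : 0 <= x -> x <= y -> y <= 1 -> g x <= g y.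
Proof.
by move=> x0 xy y1; rewrite -subr_ge0 Fcn_sub// fine_ge0.
Qed.

Lemma Fcn_dyadic (t : seq bool) : g (top t) - g (bin R t) = 2 ^- size t * M t.
Proof.
have [t0 t1] := bin_itv01 (R := R) t.
have [_ _ /(_ t) mt] := martingale_measureP hM hS.
by rewrite Fcn_sub// ?ltW ?bin_lt_top// [mu _]mt.
Qed.

Lemma slope_Fcn_dyadic (t : seq bool) : slope g (bin R t) (top t) = M t.
Proof.
rewrite slopeC /slope Fcn_dyadic /top [_ + _ - _]addrAC subrr add0r mulrAC.
by rewrite divff ?mul1r// gt_eqF// exp2V_gt0.
Qed.

(** * Success along [Z] against the derivatives at [z] *)

Variables (z : R) (Z : nat -> bool).
Hypotheses (hnd : ~ dyadic z) (hZ : binary_expansion Z z).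

Let z_itv n : bin R (mkseq Z n) < z < top (mkseq Z n).
Proof.
have /andP[h1 h2] := binary_expansion_itv _ _ n hZ.
rewrite !lt_neqAle h1 h2 !andbT; apply/andP; split; apply/eqP => e; apply: hnd.
  by rewrite -e; exact: dyadic_bin.
by rewrite e; exact: dyadic_top.
Qed.

Lemma succeeds_lower_derivative : succeeds M Z -> lower_derivative g z = +oo%E.
Proof.
move=> sM; apply/lower_derivative_eqyP => B.
(* The maximum with 0 supplies the nonnegative slope that [dyadic_slope_ge] requires; the surplus 2
   pays for the loss that the savings property allows. *)
pose c := Num.max B 0; have [n hn] := sM (c + 2); set s := mkseq Z n in hn.
have c0 : 0 <= c by rewrite le_max lexx orbT.
have Bc : B <= c by rewrite le_max lexx.
have slope_c t : prefix s t -> c * 2 ^- size t <= g (top t) - g (bin R t).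
  move=> /hS Mt; rewrite Fcn_dyadic mulrC ler_pM2l ?exp2V_gt0//; lra.
have /andP[sz zs] := z_itv n; rewrite -/s in sz zs.
(* The distance from [z] to the nearer end keeps [x] inside the interval of [s]. *)
exists (Num.min (z - bin R s) (top s - z)); first by rewrite lt_min !subr_gt0 sz.
move=> x xz; rewrite lt_min => /andP[]; rewrite !ltr_norml => /andP[x1 x2] /andP[x3 x4] _.
apply: (le_trans Bc); have [lt_xz|lt_zx|e] := ltgtP x z; last by rewrite e eqxx in xz.
  rewrite slopeC slope_geE//.
  by apply: (@dyadic_slope_ge _ g c s c0 Fcn_nd slope_c); lra.
rewrite slope_geE//.
by apply: (@dyadic_slope_ge _ g c s c0 Fcn_nd slope_c); lra.
Qed.

Lemma rational_derivative_succeeds : rational_derivative g z = +oo%E -> succeeds M Z.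
Proof.
(* Slopes are bounded weakly while success asks for a strict inequality, hence [B + 1]. *)
move=> /rational_derivative_eqyP h B; have [d d0 hd] := h (B + 1).
have [n nd] := exp2V_lt_gt0 d d0; exists n.
have /andP[sz zs] := z_itv n; have [s0 s1] := bin_itv01 (R := R) (mkseq Z n).
have [p hp] := bin_ratr (R := R) (mkseq Z n).
have [q hq] := top_ratr (R := R) (mkseq Z n).
have := hd p q; rewrite -hp -hq slope_Fcn_dyadic => h1.
have : B + 1 <= M (mkseq Z n); last by lra.
apply: h1; rewrite ?(ltW sz) ?(ltW zs)//.
by rewrite /top size_mkseq [_ + _ - _]addrAC subrr add0r exp2V_gt0 ltW.
Qed.

End Fcn_theory.

Theorem theorem3p6 (R : realType) (M : seq bool -> R)
    (hM : martingale M) (hS : savings M)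
    (z : R) (hz : 0 <= z <= 1) (hnd : ~ dyadic z)
    (Z : nat -> bool) (hZ : binary_expansion Z z) :
  (succeeds M Z <-> lower_derivative (Fcn hM hS) z = +oo%E) /\
  (lower_derivative (Fcn hM hS) z = +oo%E <->
     rational_derivative (Fcn hM hS) z = +oo%E).
Proof.
have i_ii := succeeds_lower_derivative hM hS z Z hnd hZ.
have ii_iii := lower_rational_derivative (Fcn hM hS) z.
have iii_i := rational_derivative_succeeds hM hS z Z hnd hZ.
by split; split => // ?; [exact/iii_i/ii_iii|exact/i_ii/iii_i].
Qed.
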